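(* Let $n\ge 1$, $\lambda>0$ and $\sigma_1\ge\dots\ge\sigma_{n-1}\ge 1$, let $\nu$ be the Lorentzian inner product $\operatorname{diag}\{\sigma_1,\sigma_1,\dots,\sigma_{n-1},\sigma_{n-1},1,-1,\lambda\}$ on the Heisenberg Lie algebra $\mathfrak{h}_{2n+1}$ in the basis $\{f_1,g_1,\dots,f_n,g_n,z\}$, and let $\mathscr{B}=\{v_1,\dots,v_{2n+1}\}$ be the orthonormal basis given by $v_{2k-1}=\frac{1}{\sqrt{\sigma_k}}f_k$, $v_{2k}=\frac{1}{\sqrt{\sigma_k}}g_k$ for $1\le k\le n-1$, $v_{2n-1}=f_n$, $v_{2n}=\frac{1}{\sqrt{\lambda}}z$, $v_{2n+1}=g_n$. Then the Levi-Civita connection $\nabla$ of $(\mathfrak{h}_{2n+1},\nu)$ satisfies $\nabla_{v_i}v_i=0$ for all $i=1,\dots,2n+1$; for every $k=1,\dots,n-1$, $$\nabla_{v_{2k-1}}v_{2k}=-\nabla_{v_{2k}}v_{2k-1}=\frac{\sqrt{\lambda}}{2\sigma_k}v_{2n},$$ $$\nabla_{v_{2k-1}}v_{2n}=\nabla_{v_{2n}}v_{2k-1}=\frac{-\sqrt{\lambda}}{2\sigma_k}v_{2k},\qquad \nabla_{v_{2k}}v_{2n}=\nabla_{v_{2n}}v_{2k}=\frac{\sqrt{\lambda}}{2\sigma_k}v_{2k-1};$$ $$\nabla_{v_{2n-1}}v_{2n}=\nabla_{v_{2n}}v_{2n-1}=\frac{\sqrt{\lambda}}{2}v_{2n+1},\qquad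 \nabla_{v_{2n-1}}v_{2n+1}=-\nabla_{v_{2n+1}}v_{2n-1}=\frac{\sqrt{\lambda}}{2}v_{2n},$$ $$\nabla_{v_{2n}}v_{2n+1}=\nabla_{v_{2n+1}}v_{2n}=\frac{\sqrt{\lambda}}{2}v_{2n-1};$$ and all the other terms $\nabla_{v_a}v_b$ are zero.
   Context: The Heisenberg Lie algebra $\mathfrak{h}_{2n+1}$ is the real Lie algebra with basis $\{f_1,g_1,\dots,f_n,g_n,z\}$ whose only nonzero brackets of basis elements (up to antisymmetry) are $[f_i,g_i]=z$, $i=1,\dots,n$. For $n=1$ there are no $\sigma_k$. A Lorentzian inner product is a nondegenerate symmetric bilinear form of signature $(2n,1)$; an orthonormal basis $\{v_1,\dots,v_m\}$ satisfies $\langle v_i,v_j\rangle=0$ for $i\ne j$, $\langle v_i,v_i\rangle=1$ for $i<m$, and $\langle v_m,v_m\rangle=-1$. The Levi-Civita connection of $(\mathfrak{g},\langle\cdot,\cdot\rangle)$ is the bilinear map $(u,v)\mapsto\nabla_uv$ on $\mathfrak{g}$ determined by the Koszul formula $2\langle\nabla_uv,w\rangle=\langle[u,v],w\rangle+\langle[w,u],v\rangle+\langle[w,v],u\rangle$ for all $u,v,w\in\mathfrak{g}$. *)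

(* Defs.v *)
From HB Require Import structures.
From mathcomp Require Import all_boot all_order all_algebra.
From mathcomp Require Import reals.
From mathcomp Require Import zify ring.

Set Implicit Arguments.
Unset Strict Implicit.
Unset Printing Implicit Defensive.

Import Order.TTheory GRing.Theory Num.Theory.

Local Open Scope ring_scope.

Definition lie_bracket (R : realType) (V : lmodType R)
    (br : {bilinear V -> V -> V}) : Prop :=
  (forall u, br u u = 0) /\
  (forall u v w, br u (br v w) + br v (br w u) + br w (br u v) = 0).

Definition levi_civita (R : realType) (V : lmodType R)
    (br : V -> V -> V) (ip : V -> V -> R)
    (nabla : {bilinear V -> V -> V}) : Prop :=
  forall u v w,
    2 * ip (nabla u v) w = ip (br u v) w + ip (br w u) v + ip (br w v) u.

(* h_{2n+1} is R^(2n+1) in coordinates: the standard basis e_0, ..., e_{2n} is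
   f_1, g_1, ..., f_n, g_n, z in this order.  The subscripts of f and g start
   at 1, and [heis_f k], [heis_g k] are meaningful only for 1 <= k <= n. *)
Notation heis R n := ('rV[R]_(n.*2.+1)).

Definition heis_f {R : realType} {n : nat} (k : nat) : heis R n :=
  delta_mx 0 (inord k.-1.*2).

Definition heis_g {R : realType} {n : nat} (k : nat) : heis R n :=
  delta_mx 0 (inord k.-1.*2.+1).

Definition heis_z {R : realType} {n : nat} : heis R n := delta_mx 0 ord_max.

(* The bilinear extension of [f_k, g_k] = z = - [g_k, f_k], all other brackets
   of basis elements being 0. *)
Definition heis_bracket {R : realType} {n : nat} (u v : heis R n) : heis R n :=
  (\sum_(1 <= k < n.+1)
     (u 0 (inord k.-1.*2) * v 0 (inord k.-1.*2.+1) -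
      u 0 (inord k.-1.*2.+1) * v 0 (inord k.-1.*2))) *: heis_z.

(* (sigma_1, sigma_1, ..., sigma_{n-1}, sigma_{n-1}, 1, -1, lambda), n >= 1;
   only the values sigma 1, ..., sigma n.-1 are used. *)
Definition heis_diag {R : realType} (n : nat) (sigma : nat -> R) (lambda : R) :
    'rV[R]_(n.*2.+1) :=
  \row_j if (j < n.-1.*2)%N then sigma j./2.+1
         else if (j == n.-1.*2 :> nat) then 1
         else if (j == n.-1.*2.+1 :> nat) then -1
         else lambda.

Definition heis_ip {R : realType} {n : nat} (sigma : nat -> R) (lambda : R)
    (u v : heis R n) : R :=
  (u *m diag_mx (heis_diag n sigma lambda) *m v^T) 0 0.

(* v_1, ..., v_{2n+1}; note that uphalf (2k - 1) = uphalf (2k) = k. *)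
Definition heis_frame {R : realType} {n : nat} (sigma : nat -> R) (lambda : R)
    (i : nat) : heis R n :=
  if i == n.*2.-1 then heis_f n
  else if i == n.*2 then (Num.sqrt lambda)^-1 *: heis_z
  else if i == n.*2.+1 then heis_g n
  else (Num.sqrt (sigma (uphalf i)))^-1 *:
         (if odd i then heis_f (uphalf i) else heis_g (uphalf i)).

(* The pairs (a, b) with a != b for which nabla_{v_a} v_b is nonzero. *)
Definition heis_listed (n a b : nat) : Prop :=
  (exists2 k, (1 <= k <= n.-1)%N &
     (a, b) \in [:: (k.*2.-1, k.*2); (k.*2, k.*2.-1);
                    (k.*2.-1, n.*2); (n.*2, k.*2.-1);
                    (k.*2, n.*2); (n.*2, k.*2)]) \/
  (a, b) \in [:: (n.*2.-1, n.*2); (n.*2, n.*2.-1);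
                 (n.*2.-1, n.*2.+1); (n.*2.+1, n.*2.-1);
                 (n.*2, n.*2.+1); (n.*2.+1, n.*2)].

Lemma heis_bracket_bilinear (R : realType) (n : nat) :
  bilinear_for *:%R *:%R (@heis_bracket R n).
Proof.
split=> [v|u] a x y; rewrite /heis_bracket /= scalerA -scalerDl;
  congr (_ *: _); rewrite mulr_sumr -big_split;
  by apply: eq_bigr => k _ /=; rewrite !mxE; ring.
Qed.

HB.instance Definition _ (R : realType) (n : nat) :=
  bilinear_isBilinear.Build R (heis R n) (heis R n) (heis R n) *:%R *:%R
    (@heis_bracket R n) (@heis_bracket_bilinear R n).

Lemma heis_bracket_skew (R : realType) (n : nat) (u v : heis R n) :
  heis_bracket v u = - heis_bracket u v.
Proof.
rewrite /heis_bracket -scaleNr -sumrN; congr (_ *: _).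
by apply: eq_bigr => k _; rewrite opprB !(mulrC (v _ _)).
Qed.

Lemma heis_bracketz (R : realType) (n : nat) (u : heis R n) :
  heis_bracket u heis_z = 0.
Proof.
rewrite /heis_bracket big_nat big1 ?scale0r// => k /andP[k1 kn].
have h1 : (k.-1.*2 < n.*2)%N by rewrite ltn_double prednK.
have h2 : (k.-1.*2.+1 < n.*2)%N by rewrite ltn_Sdouble prednK.
rewrite !mxE /= -!val_eqE /= !inordK; try exact: ltnW.
by rewrite (ltn_eqF h1) (ltn_eqF h2) !mulr0 subrr.
Qed.

Lemma heis_lie_bracket (R : realType) (n : nat) :
  lie_bracket (@heis_bracket R n).
Proof.
split=> [u|u v w] /=.
  rewrite /heis_bracket big1 ?scale0r// => k _.
  by rewrite [X in _ - X]mulrC subrr.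
have br0 (x y t : heis R n) : heis_bracket x (heis_bracket y t) = 0.
  by rewrite {2}/heis_bracket linearZr_LR /= heis_bracketz scaler0.
by rewrite !br0 !addr0.
Qed.

Lemma heis_bracket_basis (R : realType) (n i j : nat) :
  (1 <= i <= n)%N -> (1 <= j <= n)%N ->
  [/\ heis_bracket (heis_f i) (heis_g j) =
        (if i == j then heis_z else 0) :> heis R n,
      heis_bracket (heis_f i) (heis_f j) = 0 :> heis R n &
      heis_bracket (heis_g i) (heis_g j) = 0 :> heis R n].
Proof.
move=> /andP[i1 lein] /andP[j1 lejn].
have lt1 k : (0 < k)%N -> (k <= n)%N -> (k.-1.*2 < n.*2.+1)%N by lia.
have lt2 k : (0 < k)%N -> (k <= n)%N -> (k.-1.*2.+1 < n.*2.+1)%N by lia.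
have e0 k l : (0 < k)%N -> (k <= n)%N -> (0 < l)%N -> (l <= n)%N ->
  [/\ (@heis_f R n k) 0 (inord l.-1.*2) = (l == k)%:R,
      (@heis_f R n k) 0 (inord l.-1.*2.+1) = 0,
      (@heis_g R n k) 0 (inord l.-1.*2.+1) = (l == k)%:R &
      (@heis_g R n k) 0 (inord l.-1.*2) = 0].
  move=> k1 kn l1 ln; rewrite !mxE /= -!val_eqE /= !inordK ?lt1 ?lt2//.
  by split; first [congr (nat_of_bool _)%:R | rewrite -[RHS]/((false : nat)%:R);
    congr (nat_of_bool _)%:R]; lia.
split.
- have -> : (if i == j then heis_z else 0) = (i == j)%:R *: @heis_z R n.
    by case: eqP => _; rewrite ?scale1r ?scale0r.
  congr (_ *: _); rewrite (bigD1_seq i) ?iota_uniq ?mem_index_iota ?i1 //=.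
  have [-> -> _ _] := e0 i i i1 lein i1 lein; have [_ _ -> _] := e0 j i j1 lejn i1 lein.
  rewrite eqxx mul1r mul0r subr0 big_seq_cond big1 ?addr0// => k.
  rewrite mem_index_iota => /andP[/andP[k1 kn] /negPf ki].
  have [-> -> _ _] := e0 i k i1 lein k1 kn.
  by rewrite ki !mul0r subr0.
- rewrite /heis_bracket big_nat big1 ?scale0r// => k /andP[k1 kn].
  have [_ -> _ _] := e0 i k i1 lein k1 kn; have [_ -> _ _] := e0 j k j1 lejn k1 kn.
  by rewrite mulr0 mul0r subr0.
- rewrite /heis_bracket big_nat big1 ?scale0r// => k /andP[k1 kn].
  have [_ _ _ ->] := e0 i k i1 lein k1 kn; have [_ _ _ ->] := e0 j k j1 lejn k1 kn.
  by rewrite mulr0 mul0r subr0.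
Qed.

Lemma heis_ipE (R : realType) (n : nat) (sigma : nat -> R) (lambda : R)
    (u v : heis R n) :
  heis_ip sigma lambda u v =
  \sum_j u 0 j * heis_diag n sigma lambda 0 j * v 0 j.
Proof.
rewrite /heis_ip mxE; apply: eq_bigr => j _.
by rewrite mul_mx_diag !mxE.
Qed.

Lemma heis_ip_delta (R : realType) (n : nat) (sigma : nat -> R) (lambda : R)
    (u : heis R n) (i : 'I_n.*2.+1) :
  heis_ip sigma lambda u (delta_mx 0 i) =
  u 0 i * heis_diag n sigma lambda 0 i.
Proof.
rewrite heis_ipE (bigD1 i)//= big1 ?addr0 => [|j /negPf ji];
  by rewrite [delta_mx _ _ _ _]mxE /= ?ji ?eqxx ?mulr0 ?mulr1.
Qed.

Section Frame.
Variables (R : realType) (n : nat) (sigma : nat -> R) (lambda : R).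
Hypotheses (n_gt0 : (1 <= n)%N) (lambda_gt0 : 0 < lambda).
Hypothesis sigma_ge1 : forall k, (1 <= k <= n.-1)%N -> 1 <= sigma k.

Local Notation ip := (@heis_ip R n sigma lambda).
Local Notation d := (heis_diag n sigma lambda 0).
Local Notation v := (@heis_frame R n sigma lambda).

Lemma heis_diag_neq0 j : d j != 0.
Proof.
rewrite mxE; case: ifP => jn.
  apply: lt0r_neq0; apply: lt_le_trans ltr01 (sigma_ge1 _); lia.
by do 2?case: ifP => _; rewrite ?oppr_eq0 ?oner_neq0// lt0r_neq0.
Qed.

Lemma heis_frame_orthonormal i j :
  (1 <= i <= n.*2.+1)%N -> (1 <= j <= n.*2.+1)%N ->
  ip (v i) (v j) =
  if i != j then 0 else if i == n.*2.+1 then -1 else 1.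
Proof.
pose p i := if i == n.*2 then n.*2 else if i == n.*2.+1 then n.*2.-1 else i.-1.
pose c i := if i == n.*2 then (Num.sqrt lambda)^-1 else
  if (i < n.*2.-1)%N then (Num.sqrt (sigma (uphalf i)))^-1 else 1.
have vE k : (1 <= k <= n.*2.+1)%N -> v k = c k *: delta_mx 0 (inord (p k)).
  move=> /andP[k0 kn]; rewrite /heis_frame /c /p /heis_f /heis_g /heis_z.
  have [k1|k1] := eqVneq k n.*2.-1.
    rewrite (_ : (k == n.*2) = false); last by lia.
    rewrite (_ : (k == n.*2.+1) = false); last by lia.
    rewrite (_ : (k < n.*2.-1)%N = false); last by lia.
    by rewrite scale1r; congr (delta_mx _ (inord _)); lia.
  have [k2|k2] := eqVneq k n.*2.
    by congr (_ *: delta_mx _ _); apply: val_inj; rewrite /= inordK.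
  have [k3|k3] := eqVneq k n.*2.+1.
    rewrite (_ : (k < n.*2.-1)%N = false); last by lia.
    by rewrite scale1r; congr (delta_mx _ (inord _)); lia.
  rewrite (_ : (k < n.*2.-1)%N); last by lia.
  by congr (_ *: _); case: ifP => ok; congr (delta_mx _ (inord _)); lia.
have pl k : (1 <= k <= n.*2.+1)%N -> (p k < n.*2.+1)%N.
  by rewrite /p; do 2?case: eqP; lia.
move=> hi hj; rewrite (vE i hi) (vE j hj).
have -> : ip (c i *: delta_mx 0 (inord (p i))) (c j *: delta_mx 0 (inord (p j)))
  = c j * ip (c i *: delta_mx 0 (inord (p i))) (delta_mx 0 (inord (p j))).
  rewrite !heis_ipE mulr_sumr; apply: eq_bigr => k _.
  by rewrite [(c j *: delta_mx 0 _ : heis R n) _ _]mxE; ring.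
rewrite heis_ip_delta !mxE /= -val_eqE /= !inordK ?pl//.
have -> : (p j == p i) = (i == j).
  rewrite /p; have [ej|ej] := eqVneq j n.*2; have [ei|ei] := eqVneq i n.*2;
  have [fj|fj] := eqVneq j n.*2.+1; have [fi|fi] := eqVneq i n.*2.+1; lia.
case: eqP => [<-{j hj}|] /=; last by rewrite mulr0 mul0r mulr0.
rewrite mulr1 mulrA /c /p.
have sqK x : 0 < x -> (Num.sqrt x)^-1 * (Num.sqrt x)^-1 * x = 1 :> R.
  by move=> x0; rewrite -invfM -expr2 sqr_sqrtr ?ltW// mulVf// lt0r_neq0.
have [i1|i1] := eqVneq i n.*2.
  rewrite (_ : (i == n.*2.+1) = false); last by lia.
  rewrite (_ : (n.*2 < n.-1.*2)%N = false); last by lia.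
  rewrite (_ : (n.*2 == n.-1.*2) = false); last by lia.
  rewrite (_ : (n.*2 == n.-1.*2.+1) = false); last by lia.
  exact: sqK.
have [i2|i2] := eqVneq i n.*2.+1.
  rewrite (_ : (i < n.*2.-1)%N = false); last by lia.
  rewrite (_ : (n.*2.-1 < n.-1.*2)%N = false); last by lia.
  rewrite (_ : (n.*2.-1 == n.-1.*2) = false); last by lia.
  rewrite (_ : (n.*2.-1 == n.-1.*2.+1)); last by lia.
  by rewrite !mul1r.
have [i3|i3] := ltnP i n.*2.-1; last first.
  rewrite (_ : (i.-1 < n.-1.*2)%N = false); last by lia.
  rewrite (_ : (i.-1 == n.-1.*2)); last by lia.
  by rewrite !mul1r.
rewrite (_ : (i.-1 < n.-1.*2)%N); last by lia.
rewrite (_ : i.-1./2.+1 = uphalf i); last by lia.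
by rewrite sqK//; apply: lt_le_trans ltr01 (sigma_ge1 _); lia.
Qed.

Definition heis_connection (x y : heis R n) : heis R n :=
  \row_j ((ip (heis_bracket x y) (delta_mx 0 j) +
           ip (heis_bracket (delta_mx 0 j) x) y +
           ip (heis_bracket (delta_mx 0 j) y) x) / (2 * d j)).

Lemma heis_ip_bilinear : bilinear_for *%R *%R ip.
Proof.
split=> [y|y] a x x' /=; rewrite !heis_ipE mulr_sumr -big_split;
  apply: eq_bigr => j _ /=;
  rewrite (_ : (a *: x + x') 0 j = a * x 0 j + x' 0 j) ?[LHS]mxE ?[(a *: x) _ _]mxE//; ring.
Qed.

HB.instance Definition _ :=
  bilinear_isBilinear.Build R (heis R n) (heis R n) R *%R *%R ip
    heis_ip_bilinear.

Lemma heis_connection_bilinear : bilinear_for *:%R *:%R heis_connection.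
Proof.
split=> [y|y] a x x' /=; apply/rowP => j; rewrite !mxE;
by rewrite ?linearPl ?linearPr /= ?linearPl ?linearPr /=; ring.
Qed.

HB.instance Definition _ :=
  bilinear_isBilinear.Build R (heis R n) (heis R n) (heis R n) *:%R *:%R
    heis_connection heis_connection_bilinear.

Lemma heis_connection_levi_civita : levi_civita heis_bracket ip heis_connection.
Proof.
move=> x y w; rewrite [w]row_sum_delta.
rewrite !linear_sumr /= !linear_sumlz /= mulr_sumr -!big_split.
apply: eq_bigr => j _ /=.
have brZ a u t : heis_bracket (a *: u) t = a *: heis_bracket u t :> heis R n.
  exact: linearZl_LR.
have ipZl a u t : ip (a *: u) t = a * ip u t by exact: linearZl_LR.
have ipZr a u t : ip u (a *: t) = a * ip u t by exact: linearZr_LR.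
rewrite !ipZr !brZ !(ipZl (w 0 j)) [ip (heis_connection x y) _]heis_ip_delta mxE.
rewrite -!mulrDr mulrCA; congr (_ * _).
by rewrite mulrC -!mulrA (mulrC (d j)) mulVf ?mulr1// mulf_neq0 ?pnatr_eq0 ?heis_diag_neq0.
Qed.

Lemma heis_connection_unique (nabla : {bilinear heis R n -> heis R n -> heis R n}) :
  levi_civita heis_bracket ip nabla -> forall x y, nabla x y = heis_connection x y.
Proof.
move=> hn x y; apply/rowP => j; apply: (mulIf (heis_diag_neq0 j)).
have two0 : (2 : R) != 0 by rewrite pnatr_eq0.
by apply: (mulfI two0); rewrite -!heis_ip_delta hn heis_connection_levi_civita.
Qed.

End Frame.

(* Main.v *)
Require Import Defs.
From mathcomp Require Import all_boot all_order all_algebra.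
From mathcomp Require Import reals.
From mathcomp Require Import zify ring.

Set Implicit Arguments.
Unset Strict Implicit.
Unset Printing Implicit Defensive.

Import Order.TTheory GRing.Theory Num.Theory.

Local Open Scope ring_scope.

(** The Heisenberg algebra is two-step nilpotent with one-dimensional derived
    algebra, so everything is carried by one skew map.  Let zeta be the unit
    vector spanning the centre, and let j be defined by
    <j u, w> = <[u, w], zeta>; since zeta is a unit vector spanning the derived
    algebra, [u, w] = <j u, w> zeta.  Substituting this in the Koszul formula
    turns each of its three terms into a multiple of an inner product with the
    test vector, and nondegeneracy gives ([levi_civita_two_step])
      2 nabla_u w = <j u, w> zeta - <w, zeta> j u - <u, zeta> j w.

    The map j acts on the frame in a very simple way: it kills zeta and, up to
    a scalar, exchanges the two vectors coming from each pair f_k, g_k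
    ([heis_j_frame]).  For k < n it is the rotation by sqrt lambda / sigma_k;
    for k = n it is a boost, because g_n is timelike and the sign of <g_n, g_n>
    enters one of the two coefficients.  As the frame is orthonormal,
    nabla_(v_a) v_b is then nonzero exactly when v_a is not zeta and v_b is its
    partner, or when one of the two is zeta and the other is not: these are
    [levi_civita_partner], [levi_civita_zeta] and [levi_civita_eq0]. *)

(** * Brackets and inner products with the generators *)

Lemma heis_bracket_f (R : realType) (n k : nat) (w : heis R n) :
  (1 <= k <= n)%N ->
  heis_bracket (heis_f k) w = w 0 (inord k.-1.*2.+1) *: heis_z.
Proof.
move=> hk; congr (_ *: _).
rewrite (bigD1_seq k) ?iota_uniq ?mem_index_iota//= big_seq_cond big1 ?addr0.
  rewrite !mxE /= -!val_eqE /= !inordK; try lia.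
  have -> : (k.-1.*2.+1 == k.-1.*2) = false by lia.
  by rewrite eqxx mul1r mul0r subr0.
move=> l; rewrite mem_index_iota => /andP[hl /negPf lk].
rewrite !mxE /= -!val_eqE /= !inordK; try lia.
by do 2 (rewrite (_ : (_ == _) = false); last lia); rewrite !mul0r subr0.
Qed.

Lemma heis_bracket_g (R : realType) (n k : nat) (w : heis R n) :
  (1 <= k <= n)%N ->
  heis_bracket (heis_g k) w = - w 0 (inord k.-1.*2) *: heis_z.
Proof.
move=> hk; congr (_ *: _).
rewrite (bigD1_seq k) ?iota_uniq ?mem_index_iota//= big_seq_cond big1 ?addr0.
  rewrite !mxE /= -!val_eqE /= !inordK; try lia.
  have -> : (k.-1.*2 == k.-1.*2.+1) = false by lia.
  by rewrite eqxx mul1r mul0r sub0r.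
move=> l; rewrite mem_index_iota => /andP[hl /negPf lk].
rewrite !mxE /= -!val_eqE /= !inordK; try lia.
by do 2 (rewrite (_ : (_ == _) = false); last lia); rewrite !mul0r subr0.
Qed.

Lemma heis_ipC (R : realType) (n : nat) (sigma : nat -> R) (lambda : R)
    (u w : heis R n) :
  heis_ip sigma lambda u w = heis_ip sigma lambda w u.
Proof. by rewrite !heis_ipE; apply: eq_bigr => j _; ring. Qed.

Lemma heis_ipDl (R : realType) (n : nat) (sigma : nat -> R) (lambda : R)
    (u u' w : heis R n) :
  heis_ip sigma lambda (u + u') w =
  heis_ip sigma lambda u w + heis_ip sigma lambda u' w.
Proof. by rewrite /heis_ip !mulmxDl mxE. Qed.

Lemma heis_ipZl (R : realType) (n : nat) (sigma : nat -> R) (lambda a : R)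
    (u w : heis R n) :
  heis_ip sigma lambda (a *: u) w = a * heis_ip sigma lambda u w.
Proof. by rewrite /heis_ip -!scalemxAl mxE. Qed.

Lemma heis_bracketZl (R : realType) (n : nat) (a : R) (u w : heis R n) :
  heis_bracket (a *: u) w = a *: heis_bracket u w.
Proof. exact: linearZl_LR. Qed.

(** * The action of the skew map of the centre on the frame *)

(** The involution on 1, ..., 2n+1 induced by f_k <-> g_k; the last pair is
    numbered 2n-1, 2n+1, the centre taking the number 2n in between. *)
Definition heis_partner (n a : nat) : nat :=
  if a == n.*2 then n.*2
  else if a == n.*2.-1 then n.*2.+1
  else if a == n.*2.+1 then n.*2.-1
  else if odd a then a.+1 else a.-1.

(** The scalars such that j v_a is [sqrt lambda * weight a] times the partner of
    v_a.  The map j is skew for the inner product, so the two weights of a pair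
    are opposite when both vectors are spacelike and equal when one of them is
    timelike. *)
Definition heis_weight {R : realType} (n : nat) (sigma : nat -> R) (a : nat) :
    R :=
  if a == n.*2 then 0
  else if (a == n.*2.-1) || (a == n.*2.+1) then -1
  else if odd a then (sigma (uphalf a))^-1 else - (sigma (uphalf a))^-1.

Section LorentzianHeisenberg.
Variables (R : realType) (n : nat) (sigma : nat -> R) (lambda : R).
Hypotheses (n_gt0 : (1 <= n)%N) (lambda_gt0 : 0 < lambda).
Hypothesis sigma_ge1 : forall k, (1 <= k <= n.-1)%N -> 1 <= sigma k.

Local Notation ip := (@heis_ip R n sigma lambda).
Local Notation v := (@heis_frame R n sigma lambda).
Local Notation s := (Num.sqrt lambda).
Local Notation zeta := (v n.*2).
Local Notation partner := (heis_partner n).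
Local Notation weight := (heis_weight n sigma).

Lemma sqrt_lambda_neq0 : s != 0.
Proof. by rewrite lt0r_neq0// sqrtr_gt0. Qed.

Lemma heis_frame_z : zeta = s^-1 *: heis_z.
Proof.
by rewrite /heis_frame (_ : (_ == _.-1) = false) ?eqxx//; lia.
Qed.

Lemma heis_frame_f (k : nat) : (1 <= k <= n.-1)%N ->
  v k.*2.-1 = (Num.sqrt (sigma k))^-1 *: heis_f k.
Proof.
move=> hk; rewrite /heis_frame.
do 3 (rewrite (_ : (k.*2.-1 == _) = false); last lia).
have -> : uphalf k.*2.-1 = k by lia.
by have -> : odd k.*2.-1 by lia.
Qed.

Lemma heis_frame_g (k : nat) : (1 <= k <= n.-1)%N ->
  v k.*2 = (Num.sqrt (sigma k))^-1 *: heis_g k.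
Proof.
move=> hk; rewrite /heis_frame.
do 3 (rewrite (_ : (k.*2 == _) = false); last lia).
by rewrite uphalf_double odd_double.
Qed.

Lemma heis_frame_fn : v n.*2.-1 = heis_f n.
Proof. by rewrite /heis_frame eqxx. Qed.

Lemma heis_frame_gn : v n.*2.+1 = heis_g n.
Proof.
rewrite /heis_frame; do 2 (rewrite (_ : (n.*2.+1 == _) = false); last lia).
by rewrite eqxx.
Qed.

Lemma heis_ip_f (k : nat) (w : heis R n) : (1 <= k <= n)%N ->
  ip (heis_f k) w = (if k == n then 1 else sigma k) * w 0 (inord k.-1.*2).
Proof.
move=> hk; rewrite heis_ipC heis_ip_delta mulrC mxE inordK; last by lia.
have [->|kn] := eqVneq k n; first by rewrite ltnn eqxx.
rewrite (_ : (_ < _)%N); last by lia.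
by have -> : (k.-1.*2)./2.+1 = k by lia.
Qed.

Lemma heis_ip_g (k : nat) (w : heis R n) : (1 <= k <= n)%N ->
  ip (heis_g k) w = (if k == n then -1 else sigma k) * w 0 (inord k.-1.*2.+1).
Proof.
move=> hk; rewrite heis_ipC heis_ip_delta mulrC mxE inordK; last by lia.
have [->|kn] := eqVneq k n.
  rewrite (_ : (_ < _)%N = false); last by lia.
  by rewrite (_ : (n.-1.*2.+1 == n.-1.*2) = false) ?eqxx//; lia.
rewrite (_ : (_ < _)%N); last by lia.
by have -> : (k.-1.*2.+1)./2.+1 = k by lia.
Qed.

Lemma heis_ip_zz : ip heis_z zeta = s.
Proof.
rewrite heis_frame_z heis_ipC heis_ipZl heis_ip_delta !mxE /= eqxx mul1r.
do 3 (rewrite ifF; last lia).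
rewrite -[X in _ * X](@sqr_sqrtr _ lambda) ?ltW// expr2 mulrA mulVf ?mul1r//.
exact: sqrt_lambda_neq0.
Qed.

(** The derived algebra is the line of the unit vector [zeta], so a bracket is
    recovered from its [zeta]-component. *)
Lemma heis_bracket_central (u w : heis R n) :
  heis_bracket u w = ip (heis_bracket u w) zeta *: zeta.
Proof.
rewrite [heis_bracket u w]/heis_bracket heis_ipZl heis_ip_zz heis_frame_z.
by rewrite scalerA mulfK// sqrt_lambda_neq0.
Qed.

(** The connection of a two-step nilpotent algebra with one-dimensional derived
    algebra, in terms of the skew map j.  Only the values of j at u and w matter;
    they are passed as vectors, characterised by their inner products. *)
Lemma levi_civita_two_step (nabla : {bilinear heis R n -> heis R n -> heis R n})
    (u w Ju Jw : heis R n) :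
  levi_civita heis_bracket ip nabla ->
  (forall x, ip Ju x = ip (heis_bracket u x) zeta) ->
  (forall x, ip Jw x = ip (heis_bracket w x) zeta) ->
  nabla u w =
  2^-1 *: (ip Ju w *: zeta - ip w zeta *: Ju - ip u zeta *: Jw).
Proof.
move=> nabla_lc hu hw; apply/rowP => j.
(* Testing against the basis vectors reads off coordinates, up to the nonzero
   diagonal entries of the form. *)
apply: (mulIf (heis_diag_neq0 n_gt0 lambda_gt0 sigma_ge1 j)).
have two0 : (2 : R) != 0 by rewrite pnatr_eq0.
apply: (mulfI two0); rewrite -!heis_ip_delta nabla_lc.
set e := delta_mx 0 j.
rewrite (heis_bracket_skew u e) (heis_bracket_skew w e).
rewrite (heis_bracket_central u w) (heis_bracket_central u e).
rewrite (heis_bracket_central w e) -!hu -!hw -!scaleNr.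
rewrite !heis_ipZl !heis_ipDl !heis_ipZl mulrA mulfV// mul1r.
by rewrite !(heis_ipC _ _ zeta); ring.
Qed.

(** For k < n, f_k has norm sigma_k and bracket 1 with g_k, so passing from the
    dual vector of f_k to g_k itself divides by sigma_k; normalising both
    vectors of the pair by the same factor does not change this ratio. *)
Lemma heis_j_frame (a : nat) (w : heis R n) : (1 <= a <= n.*2.+1)%N ->
  ip ((s * weight a) *: v (partner a)) w = ip (heis_bracket (v a) w) zeta.
Proof.
move=> ha; rewrite /heis_weight /heis_partner heis_ipZl.
have [->|a1] := eqVneq a n.*2.
  rewrite mulr0 mul0r heis_frame_z heis_bracketZl heis_bracket_skew.
  by rewrite heis_bracketz oppr0 scaler0 /heis_ip !mul0mx mxE.
have [->|a2] := eqVneq a n.*2.-1.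
  rewrite heis_frame_fn heis_frame_gn heis_ip_g; last by lia.
  rewrite heis_bracket_f; last by lia.
  by rewrite heis_ipZl heis_ip_zz eqxx /=; ring.
have [->|a3] := eqVneq a n.*2.+1.
  rewrite heis_frame_fn heis_frame_gn heis_ip_f; last by lia.
  rewrite heis_bracket_g; last by lia.
  by rewrite heis_ipZl heis_ip_zz eqxx /=; ring.
have hk : (1 <= uphalf a <= n.-1)%N by lia.
have hkn : (1 <= uphalf a <= n)%N by lia.
have kn : (uphalf a == n) = false by lia.
have sk0 : sigma (uphalf a) != 0.
  by rewrite lt0r_neq0// (lt_le_trans ltr01)// sigma_ge1.
have [ao|ao] /= := boolP (odd a).
  rewrite (_ : a.+1 = (uphalf a).*2); last by lia.
  rewrite (_ : v a = v (uphalf a).*2.-1); last by congr heis_frame; lia.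
  rewrite (heis_frame_f hk) (heis_frame_g hk) heis_bracketZl heis_bracket_f//.
  rewrite !heis_ipZl heis_ip_zz heis_ip_g// kn.
  by move: (Num.sqrt (sigma _))^-1 => r; field.
rewrite (_ : a.-1 = (uphalf a).*2.-1); last by lia.
rewrite (_ : v a = v (uphalf a).*2); last by congr heis_frame; lia.
rewrite (heis_frame_f hk) (heis_frame_g hk) heis_bracketZl heis_bracket_g//.
rewrite !heis_ipZl heis_ip_zz heis_ip_f// kn.
by move: (Num.sqrt (sigma _))^-1 => r; field.
Qed.

Lemma partner_range (a : nat) :
  (1 <= a <= n.*2.+1)%N -> (1 <= partner a <= n.*2.+1)%N.
Proof. by rewrite /heis_partner; do 4?case: ifP; lia. Qed.

Lemma partner_neq (a : nat) : a != n.*2 -> (1 <= a <= n.*2.+1)%N ->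
  (partner a != n.*2) && (partner a != a).
Proof. by rewrite /heis_partner; do 4?case: ifP; lia. Qed.

(** * The connection on the frame *)

Section Connection.
Variable nabla : {bilinear heis R n -> heis R n -> heis R n}.
Hypothesis nabla_lc : levi_civita heis_bracket ip nabla.

Let zeta_range : (1 <= n.*2 <= n.*2.+1)%N. Proof. by lia. Qed.

Lemma levi_civita_frame (a b : nat) :
  (1 <= a <= n.*2.+1)%N -> (1 <= b <= n.*2.+1)%N ->
  nabla (v a) (v b) =
  2^-1 *: ((s * weight a * ip (v (partner a)) (v b)) *: zeta
           - ip (v b) zeta *: ((s * weight a) *: v (partner a))
           - ip (v a) zeta *: ((s * weight b) *: v (partner b))).
Proof.
move=> ha hb; rewrite -heis_ipZl; apply: levi_civita_two_step => // x;
  exact: heis_j_frame.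
Qed.

Lemma heis_frame_zeta (a : nat) : (1 <= a <= n.*2.+1)%N ->
  ip (v a) zeta = (a == n.*2)%:R.
Proof.
move=> ha; rewrite heis_frame_orthonormal//.
by case: eqVneq => [->|//]; rewrite ifF//; lia.
Qed.

Lemma levi_civita_zeta (a : nat) : (1 <= a <= n.*2.+1)%N -> a != n.*2 ->
  nabla (v a) zeta = (- (s / 2) * weight a) *: v (partner a) /\
  nabla zeta (v a) = (- (s / 2) * weight a) *: v (partner a).
Proof.
move=> ha an; have pr := partner_range ha.
have /andP[pn pa] := partner_neq an ha.
have w0 : weight n.*2 = 0 by rewrite /heis_weight eqxx.
have p0 : partner n.*2 = n.*2 by rewrite /heis_partner eqxx.
rewrite !levi_civita_frame// w0 p0 (heis_ipC _ _ zeta) !heis_frame_zeta//.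
rewrite eqxx (negPf an) (negPf pn) !mulr0 !scale0r !scale1r.
by rewrite !subr0 !sub0r !scalerN !scalerA -!scaleNr; split; congr (_ *: _); ring.
Qed.

(** Each weight enters through < j v_a, v_b > with v_b the partner of v_a, whose
    norm is -1 when v_b is the timelike v_(2n+1), that is when a = 2n-1. *)
Lemma levi_civita_partner (a : nat) : (1 <= a <= n.*2.+1)%N -> a != n.*2 ->
  nabla (v a) (v (partner a)) =
  (s / 2 * (if a == n.*2.-1 then - weight a else weight a)) *: zeta.
Proof.
move=> ha an; have pr := partner_range ha.
have /andP[pn pa] := partner_neq an ha.
rewrite levi_civita_frame// !heis_frame_zeta// (negPf an) (negPf pn).
rewrite !scale0r !subr0 heis_frame_orthonormal// eqxx /=.
have -> : (partner a == n.*2.+1) = (a == n.*2.-1).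
  by rewrite /heis_partner; do 4?case: ifP; lia.
by rewrite scalerA; congr (_ *: _); case: ifP => _; ring.
Qed.

Lemma levi_civita_eq0 (a b : nat) :
  (1 <= a <= n.*2.+1)%N -> (1 <= b <= n.*2.+1)%N ->
  (a == b) || [&& a != n.*2, b != n.*2 & b != partner a] ->
  nabla (v a) (v b) = 0.
Proof.
move=> ha hb hab; have pr := partner_range ha.
rewrite levi_civita_frame// !heis_frame_zeta//.
have [an|an] := eqVneq a n.*2.
  have <- : a = b by lia.
  by rewrite /heis_weight an eqxx !mulr0 !mul0r !scale0r !scaler0 !subr0 scaler0.
have /andP[pn pa] := partner_neq an ha.
have -> : (b == n.*2) = false by lia.
rewrite heis_frame_orthonormal// ifT; last by lia.
by rewrite mulr0 !scale0r !subr0 scaler0.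
Qed.

End Connection.
End LorentzianHeisenberg.

(** The pairs not covered by [levi_civita_eq0] are exactly a frame vector with
    its partner, or with [zeta], in either order; sorting them by the pair
    f_k, g_k involved gives the listed ones. *)
Lemma heis_listedI (n a b : nat) :
  (1 <= a <= n.*2.+1)%N -> (1 <= b <= n.*2.+1)%N ->
  ~~ ((a == b) || [&& a != n.*2, b != n.*2 & b != heis_partner n a]) ->
  heis_listed n a b.
Proof.
move=> ha hb; rewrite negb_or => /andP[/eqP ab h].
have paired c : (1 <= c <= n.*2.+1)%N -> c <> n.*2 ->
    (exists2 k, (1 <= k <= n.-1)%N & c \in [:: k.*2.-1; k.*2]) \/
    c \in [:: n.*2.-1; n.*2.+1].
  move=> hc cn; have [ck|ck] := ltnP c n.*2.-1; last by right; rewrite !inE; lia.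
  by left; exists (uphalf c); rewrite ?inE; lia.
have [an|/eqP an] := eqVneq a n.*2.
  have bn : b <> n.*2 by move=> bn; apply: ab; rewrite an bn.
  case: (paired b hb bn) => [[k hk]|]; rewrite an !inE => /orP[]/eqP->;
    [left; exists k => // | left; exists k => // | right | right];
    by rewrite !inE !eqxx ?orbT.
have [bn|/eqP bn] := eqVneq b n.*2.
  case: (paired a ha an) => [[k hk]|]; rewrite bn !inE => /orP[]/eqP->;
    [left; exists k => // | left; exists k => // | right | right];
    by rewrite !inE !eqxx ?orbT.
have {h} -> : b = heis_partner n a by lia.
case: (paired a ha an) => [[k hk]|]; rewrite !inE => /orP[]/eqP->;
    [left; exists k => // | left; exists k => // | right | right];
  rewrite /heis_partner; do ?[rewrite ifF; last by lia]; rewrite ?eqxx;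
  do ?[rewrite ifT; last by lia]; rewrite !inE ?xpair_eqE; lia.
Qed.

Theorem theorem3p7 (R : realType) (n : nat) (lambda : R) (sigma : nat -> R)
    (n_ge1 : (1 <= n)%N) (lambda_gt0 : 0 < lambda)
    (sigma_noninc : forall j k : nat,
       (1 <= j)%N -> (j <= k)%N -> (k <= n.-1)%N -> sigma k <= sigma j)
    (sigma_ge1 : forall k : nat, (1 <= k <= n.-1)%N -> 1 <= sigma k)
    (nabla : {bilinear heis R n -> heis R n -> heis R n})
    (nabla_lc : levi_civita heis_bracket (heis_ip sigma lambda) nabla) :
  let v := @heis_frame R n sigma lambda in
  let s := Num.sqrt lambda in
  [/\ forall i, (1 <= i <= n.*2.+1)%N -> nabla (v i) (v i) = 0,
      forall k, (1 <= k <= n.-1)%N ->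
        [/\ nabla (v k.*2.-1) (v k.*2) = (s / (2 * sigma k)) *: v n.*2,
            - nabla (v k.*2) (v k.*2.-1) = (s / (2 * sigma k)) *: v n.*2,
            nabla (v k.*2.-1) (v n.*2) = (- s / (2 * sigma k)) *: v k.*2,
            nabla (v n.*2) (v k.*2.-1) = (- s / (2 * sigma k)) *: v k.*2 &
            nabla (v k.*2) (v n.*2) = (s / (2 * sigma k)) *: v k.*2.-1 /\
            nabla (v n.*2) (v k.*2) = (s / (2 * sigma k)) *: v k.*2.-1],
      [/\ nabla (v n.*2.-1) (v n.*2) = (s / 2) *: v n.*2.+1,
          nabla (v n.*2) (v n.*2.-1) = (s / 2) *: v n.*2.+1,
          nabla (v n.*2.-1) (v n.*2.+1) = (s / 2) *: v n.*2,
          - nabla (v n.*2.+1) (v n.*2.-1) = (s / 2) *: v n.*2 &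
          nabla (v n.*2) (v n.*2.+1) = (s / 2) *: v n.*2.-1 /\
          nabla (v n.*2.+1) (v n.*2) = (s / 2) *: v n.*2.-1] &
      forall a b, (1 <= a <= n.*2.+1)%N -> (1 <= b <= n.*2.+1)%N ->
        ~ heis_listed n a b -> nabla (v a) (v b) = 0].
Proof.
move=> v s.
have lcz := levi_civita_zeta n_ge1 lambda_gt0 sigma_ge1 nabla_lc.
have lcp := levi_civita_partner n_ge1 lambda_gt0 sigma_ge1 nabla_lc.
have lc0 := levi_civita_eq0 n_ge1 lambda_gt0 sigma_ge1 nabla_lc.
split.
- by move=> i hi; apply: lc0; rewrite ?eqxx.
- move=> k hk.
  have r1 : (1 <= k.*2.-1 <= n.*2.+1)%N by lia.
  have r2 : (1 <= k.*2 <= n.*2.+1)%N by lia.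
  have n1 : k.*2.-1 != n.*2 by lia.
  have n2 : k.*2 != n.*2 by lia.
  have f1 : (k.*2.-1 == n.*2.-1) = false by lia.
  have f2 : (k.*2 == n.*2.-1) = false by lia.
  have g1 : (k.*2.-1 == n.*2.+1) = false by lia.
  have g2 : (k.*2 == n.*2.+1) = false by lia.
  have o1 : odd k.*2.-1 by lia.
  have u1 : uphalf k.*2.-1 = k by lia.
  have p1 : heis_partner n k.*2.-1 = k.*2.
    by rewrite /heis_partner (negPf n1) f1 g1 o1; lia.
  have p2 : heis_partner n k.*2 = k.*2.-1.
    by rewrite /heis_partner (negPf n2) f2 g2 odd_double.
  have w1 : heis_weight n sigma k.*2.-1 = (sigma k)^-1.
    by rewrite /heis_weight (negPf n1) f1 g1 o1 u1.
  have w2 : heis_weight n sigma k.*2 = - (sigma k)^-1.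
    by rewrite /heis_weight (negPf n2) f2 g2 odd_double uphalf_double.
  have [z1 z1'] := lcz _ r1 n1; have [z2 z2'] := lcz _ r2 n2.
  have := lcp _ r1 n1; have := lcp _ r2 n2.
  rewrite p1 p2 f1 f2 w1 w2 /v => -> ->.
  by rewrite z1 z1' z2 z2' p1 p2 w1 w2 -scaleNr !invfM; split; [..|split];
    congr (_ *: _); rewrite /s; ring.
- have r1 : (1 <= n.*2.-1 <= n.*2.+1)%N by lia.
  have r2 : (1 <= n.*2.+1 <= n.*2.+1)%N by lia.
  have n1 : n.*2.-1 != n.*2 by lia.
  have n2 : n.*2.+1 != n.*2 by lia.
  have f2 : (n.*2.+1 == n.*2.-1) = false by lia.
  have p1 : heis_partner n n.*2.-1 = n.*2.+1.
    by rewrite /heis_partner (negPf n1) eqxx.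
  have p2 : heis_partner n n.*2.+1 = n.*2.-1.
    by rewrite /heis_partner (negPf n2) f2 eqxx.
  have w1 : heis_weight n sigma n.*2.-1 = -1.
    by rewrite /heis_weight (negPf n1) eqxx.
  have w2 : heis_weight n sigma n.*2.+1 = -1.
    by rewrite /heis_weight (negPf n2) eqxx orbT.
  have [z1 z1'] := lcz _ r1 n1; have [z2 z2'] := lcz _ r2 n2.
  have := lcp _ r1 n1; have := lcp _ r2 n2.
  rewrite p1 p2 f2 eqxx w1 w2 /v => -> ->.
  by rewrite z1 z1' z2 z2' p1 p2 w1 w2 -scaleNr; split; [..|split];
    congr (_ *: _); rewrite /s; ring.
- move=> a b ha hb unlisted; apply: lc0 => //.
  by apply/negPn/negP => hab; apply/unlisted/heis_listedI.
Qed.
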